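(* Let $\boldsymbol k$ be an algebraically closed field with $\operatorname{char}\boldsymbol k\neq 2$, let $V$ be a vector space over $\boldsymbol k$ of finite dimension $n$, let $\mathcal M:=V^*\otimes V^*\otimes V$, and let $G:=\mathrm{GL}(V)$ act naturally on $\mathcal M$. Then the field $\boldsymbol k(\mathcal M)^G$ of $G$-invariant rational functions on $\mathcal M$ is a rational extension of $\boldsymbol k$ of transcendence degree $n^3-n^2$.
   Context: A field extension $K/\boldsymbol k$ is called rational if either $K$ is a finitely generated purely transcendental extension of $\boldsymbol k$ or $K=\boldsymbol k$. Elements of $\mathcal M$ correspond to bilinear maps $V\times V\to V$ (equivalently, not necessarily associative $\boldsymbol k$-algebra structures on $V$); the action of $G$ is the natural one on the tensor product. *)

(* Defs.v *)
From HB Require Import structures.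
From mathcomp Require Import all_boot all_order all_algebra.
From mathcomp Require Import fraction.
From mathcomp.multinomials Require Import mpoly.
Set Implicit Arguments. Unset Strict Implicit. Unset Printing Implicit Defensive.
Import GRing.Theory.
Local Open Scope ring_scope.
Notation "x %:F" := (@FracField.tofrac _ x) : ring_scope.

(* Coordinates on M = V^* (x) V^* (x) V, V = k^n with standard basis e_0..e_{n-1}.
   A point mu of M (a bilinear map V x V -> V) has coordinates c(i,j,l) with
   mu(e_i, e_j) = sum_l c(i,j,l) e_l.  The coordinate index type is Idx n. *)
Definition Idx (n : nat) : finType := ('I_n * 'I_n * 'I_n)%type.
Definition Nc (n : nat) : nat := #|{: Idx n}|.

Definition PolM (k : fieldType) (n : nat) := {mpoly k[Nc n]}.
Definition RatM (k : fieldType) (n : nat) := {fraction {mpoly k[Nc n]}}.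

Definition coordM (k : fieldType) (n : nat) (t : Idx n) : {mpoly k[Nc n]} :=
  'X_(enum_rank t).

(* coordinate (i,j,l) of g.mu, where (g.mu)(u,v) = g (mu (g^-1 u, g^-1 v)),
   as a linear form in the coordinates of mu:
   (g.mu)(i,j,l) = sum_{a,b,c} h_{a i} h_{b j} g_{l c} mu(a,b,c), h = g^-1. *)
Definition act_coord (k : fieldType) (n : nat) (g : 'M[k]_n) (t : Idx n)
  : {mpoly k[Nc n]} :=
  let: (i, j, l) := t in
  \sum_(a < n) \sum_(b < n) \sum_(c < n)
     ((invmx g) a i * (invmx g) b j * g l c) *: coordM k (a, b, c).

Definition pullback (k : fieldType) (n : nat) (g : 'M[k]_n) (p : {mpoly k[Nc n]})
  : {mpoly k[Nc n]} :=
  mmap (@mpolyC _ k) (fun s : 'I_(Nc n) => act_coord g (enum_val s)) p.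

(* a rational function x in k(M) is GL(V)-invariant: writing x = p/q,
   p(g.mu)/q(g.mu) = p(mu)/q(mu) for every g in GL(V), i.e. (g^* p) q = p (g^* q).
   (This condition does not depend on the chosen representation p/q.) *)
Definition invariant (k : fieldType) (n : nat) (x : RatM k n) : Prop :=
  exists p q : {mpoly k[Nc n]}, q != 0 /\ x = p%:F / q%:F /\
    forall g : 'M[k]_n, g \in unitmx -> pullback g p * q = p * pullback g q.

Definition constR (k : fieldType) (n : nat) (a : k) : RatM k n := (a%:MP)%:F.

Definition evalR (k : fieldType) (n d : nat) (P : {mpoly k[d]})
  (f : 'I_d -> RatM k n) : RatM k n :=
  mmap (@constR k n) f P.

Definition alg_indep (k : fieldType) (n d : nat) (f : 'I_d -> RatM k n) : Prop :=
  forall P : {mpoly k[d]}, P != 0 -> evalR P f != 0.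

(* The invariant field k(M)^G is a rational (purely transcendental, finitely
   generated, or trivial) extension of k of transcendence degree d:
   there are d algebraically independent invariants f_1..f_d generating
   k(M)^G as a field over k, i.e. k(M)^G = k(f_1,...,f_d).
   (For d = 0 this says k(M)^G = k.) *)
Definition invariant_field_rational_of_trdeg (k : fieldType) (n d : nat) : Prop :=
  exists f : 'I_d -> RatM k n,
    (forall i, invariant (f i)) /\ alg_indep f /\
    forall x : RatM k n, invariant x ->
      exists A B : {mpoly k[d]}, evalR B f != 0 /\ x = evalR A f / evalR B f.

(* Main.v *)
Require Import Defs.
From HB Require Import structures.
From mathcomp Require Import all_boot all_order all_algebra.
From mathcomp Require Import fraction.
From mathcomp.multinomials Require Import mpoly.
From mathcomp Require Import zify ring.
Set Implicit Arguments.
Unset Strict Implicit.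
Unset Printing Implicit Defensive.
Import GRing.Theory.
Local Open Scope ring_scope.

(* Let w be the vector with a(wv) = a(v) for all v, where a(u) = tr L_u is the
   trace of left multiplication: w exists and is unique when the bilinear form
   (u, v) |-> a(uv) is nondegenerate.  For a generic algebra, w, ww, w(ww), ...
   (n terms) is a basis of V, attached GL(V)-equivariantly to the
   multiplication.  So the structure constants in this basis are invariant and
   generate the invariant field.  A multiplication is in normal form, i.e. its
   canonical basis is the standard one, iff e_1 e_j = e_(j+1) for j < n, the
   coordinates of e_1 e_n sum to 1, and all tr L_(e_i) are equal.  These n^2
   equations are solved polynomially for n^2 of the coordinates, and the
   remaining n^3 - n^2 ones are free parameters of the set of normal forms. *)

(** * Nonvanishing of polynomials over infinite fields *)

Lemma closed_field_infinite (k : closedFieldType) (s : seq k) :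
  exists x, x \notin s.
Proof.
(* As in Euclid's argument, [p] takes the value 1 on [s], so its roots lie outside [s]. *)
pose p := \prod_(a <- s) ('X - a%:P) + 1.
have [p1|/closed_rootP[x rx]] := eqVneq (size p) 1; last first.
  exists x; apply/negP=> xs; move: rx.
  rewrite /root hornerD hornerC (_ : (\prod_(a <- s) ('X - a%:P)).[x] = 0).
    by rewrite add0r oner_eq0.
  by apply/eqP; rewrite -/(root _ x) root_prod_XsubC.
(* Here [p] is a nonzero constant, which forces [s] to be empty. *)
case: s @p p1 => [|a s] p p1; first by exists 0.
move: p1; rewrite /p size_polyDl size_prod_XsubC //.
by rewrite size_poly1.
Qed.

(** A nonzero [p] has fewer than [size p] roots, so one of [size p] distinct values of [f] is not a
    root. *)
Lemma poly_nonroot (R : idomainType) (k : eqType) (f : k -> R) (p : {poly R}) :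
  (forall s : seq k, exists x, x \notin s) -> injective f -> p != 0 ->
  exists a, p.[f a] != 0.
Proof.
move=> kinf f_inj p0.
have [s us ss] : exists2 s : seq k, uniq s & size s = size p.
  elim: (size p) => [|m [s us <-]]; first by exists [::].
  by have [x xs] := kinf s; exists (x :: s); rewrite //= xs.
have /allPn[_ /mapP[a _ ->] nra] : ~~ all (root p) (map f s).
  apply/negP=> /(max_poly_roots p0).
  by rewrite map_inj_uniq // us size_map ss ltnn => /(_ isT).
by exists a.
Qed.

Lemma widen_ord_lift_max (n : nat) (i : 'I_n) :
  widen_ord (leqnSn n) i = lift ord_max i.
Proof. by apply/val_inj; rewrite /= /bump leqNgt ltn_ord. Qed.

(** The coefficient of [p] at [m] survives in [muni p]: take the coefficient at the exponent of the
    last variable, then at the remaining monomial. *)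
Lemma muni_eq0 (R : idomainType) (n : nat) (p : {mpoly R[n.+1]}) :
  (muni p == 0) = (p == 0).
Proof.
apply/eqP/eqP=> [p0|->]; last exact: muni0.
apply/mpolyP=> m; rewrite mcoeff0.
move/(congr1 (fun q : {poly {mpoly R[n]}} => q`_(m ord_max))): p0.
move/(congr1 (mcoeff [multinom m (widen_ord (leqnSn n) i) | i < n])).
rewrite coef0 mcoeff0 => <-.
rewrite muniE coef_sum raddf_sum /=.
have E (m' : 'X_{1..n.+1}) :
  ((p@_m' *: 'X_[[multinom m' (widen_ord (leqnSn n) i) | i < n]]
      *: 'X^(m' ord_max) : {poly {mpoly R[n]}})`_(m ord_max))
    @_[multinom m (widen_ord (leqnSn n) i) | i < n]
  = p@_m' *+ (m' == m).
  rewrite coefZ coefXn; have [->|nm] := eqVneq m' m.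
    by rewrite eqxx mulr1 mcoeffZ mcoeffX eqxx mulr1.
  have [em|] := eqVneq (m ord_max) (m' ord_max); last by rewrite mulr0 mcoeff0.
  rewrite mulr1 mcoeffZ mcoeffX.
  case: eqP => [/mnmP e|]; last by rewrite mulr0.
  case/eqP: nm; apply/mnmP=> i; case: (unliftP ord_max i) => [j ->|->//].
  have := e j; rewrite !mnmE.
  by rewrite widen_ord_lift_max.
under eq_bigr do rewrite E.
have [ms|ms] := boolP (m \in msupp p).
  rewrite (bigD1_seq m) ?msupp_uniq //= eqxx big1 ?addr0 // => m' /negPf ->.
  by rewrite mulr0n.
rewrite memN_msupp_eq0 // big1_seq // => m' /= m's.
by case: eqP => [em|//]; rewrite em (negPf ms) in m's.
Qed.

(** The point on the left extends [v] by the value [a] of the last variable, as needed for induction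
    on the number of variables. *)
Lemma meval_muni (R : idomainType) (n : nat) (p : {mpoly R[n.+1]}) a
    (v : 'I_n -> R) :
  p.@[fun i => oapp v a (unlift ord_max i)] = ((muni p).[a%:MP]).@[v].
Proof.
rewrite mevalE muniE horner_sum raddf_sum /=; apply: eq_bigr => m _.
rewrite hornerZ hornerXn mevalM mevalZ mevalX rmorphXn /= mevalC.
rewrite big_ord_recr /= unlift_none /= mulrA; congr (_ * _ * _).
apply: eq_bigr => i _; rewrite mnmE.
by rewrite widen_ord_lift_max liftK.
Qed.

(** The coefficients lie in K but the point has coordinates in k, so k-points are dense in affine
    space over K. By induction: the last coordinate is chosen so that a nonzero polynomial in the
    others remains. *)
Lemma mpoly_nonzero_point (k K : fieldType) (iota : {rmorphism k -> K})
    (n : nat) (p : {mpoly K[n]}) :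
  (forall s : seq k, exists x, x \notin s) -> p != 0 ->
  exists v : 'I_n -> k, p.@[iota \o v] != 0.
Proof.
move=> kinf; elim: n => [|n IHn] in p *.
  move=> p0; exists (fun=> 0); apply: contraNneq p0 => p0.
  apply/eqP/mpolyP=> m; rewrite mcoeff0 -p0 mevalE.
  have E (m' : 'X_{1..0}) : m' = m by apply/mnmP; case.
  under eq_bigr do rewrite big_ord0 mulr1.
  have [ms|ms] := boolP (m \in msupp p).
    rewrite (bigD1_seq m) ?msupp_uniq //= big1 ?addr0 // => m'.
    by rewrite (E m') eqxx.
  rewrite memN_msupp_eq0 // big1_seq // => m' /= m's.
  by rewrite -(E m') m's in ms.
rewrite -muni_eq0 => p0.
pose f (x : k) : {mpoly K[n]} := (iota x)%:MP.
have f_inj : injective f by move=> x y /(can_inj (@mpolyCK _ _))/fmorph_inj.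
have [a /IHn[v pav]] := poly_nonroot kinf f_inj p0.
exists (fun i => oapp v a (unlift ord_max i)).
rewrite (_ : p.@[_] = ((muni p).[f a]).@[iota \o v]) // -meval_muni.
by apply: meval_eq => i /=; case: unliftP.
Qed.

(** * Specialization of rational functions *)

Section Specialization.

Variables (R : idomainType) (L : fieldType) (phi : {rmorphism R -> L}).

(* x is regular at the point phi and takes the value y there. *)
Definition specializes (x : {fraction R}) (y : L) : Prop :=
  exists a b : R, [/\ phi b != 0, x = a%:F / b%:F & y = phi a / phi b].

Lemma specializes_tofrac a : specializes a%:F (phi a).
Proof. by exists a, 1; rewrite !rmorph1 !divr1 oner_eq0. Qed.

Lemma tofrac_neq0_spec b : phi b != 0 -> b%:F != 0.
Proof.
by move=> pb; rewrite tofrac_eq0; apply: contraNneq pb => ->; rewrite rmorph0.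
Qed.

(** The value is independent of the fraction: by cross multiplication, any representation whose
    denominator does not vanish at [phi] computes it. *)
Lemma specializesP x y a b :
  specializes x y -> phi b != 0 -> x = a%:F / b%:F -> y = phi a / phi b.
Proof.
move=> [a' [b' [pb' -> ->]]] pb /eqP.
rewrite eqr_div ?tofrac_neq0_spec // -!tofracM tofrac_eq => /eqP e.
by apply/eqP; rewrite eqr_div // -!rmorphM e.
Qed.

Lemma specializesD x y x' y' :
  specializes x y -> specializes x' y' -> specializes (x + x') (y + y').
Proof.
move=> [a [b [pb -> ->]]] [a' [b' [pb' -> ->]]].
exists (a * b' + a' * b), (b * b'); rewrite !rmorphD !rmorphM /=.
by split; rewrite ?mulf_neq0 // addf_div ?tofrac_neq0_spec.
Qed.

Lemma specializesM x y x' y' :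
  specializes x y -> specializes x' y' -> specializes (x * x') (y * y').
Proof.
move=> [a [b [pb -> ->]]] [a' [b' [pb' -> ->]]].
exists (a * a'), (b * b'); rewrite !rmorphM /=.
by split; rewrite ?mulf_neq0 // mulf_div.
Qed.

Lemma specializesV x y : specializes x y -> y != 0 -> specializes x^-1 y^-1.
Proof.
move=> [a [b [pb -> ->]]] y0; exists b, a; rewrite !invf_div; split=> //.
by apply: contraNneq y0 => ->; rewrite mul0r.
Qed.

Lemma specializes0 : specializes 0 0.
Proof. by rewrite -(rmorph0 phi) -(tofrac0 R); apply: specializes_tofrac. Qed.

Lemma specializes1 : specializes 1 1.
Proof. by rewrite -(rmorph1 phi) -(tofrac1 R); apply: specializes_tofrac. Qed.

Lemma specializes_sum I (r : seq I) (P : pred I) (F : I -> {fraction R}) G :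
  (forall i, P i -> specializes (F i) (G i)) ->
  specializes (\sum_(i <- r | P i) F i) (\sum_(i <- r | P i) G i).
Proof.
move=> FG; elim/big_ind2: _ => //; first exact: specializes0.
by move=> *; apply: specializesD.
Qed.

Lemma specializes_prod I (r : seq I) (P : pred I) (F : I -> {fraction R}) G :
  (forall i, P i -> specializes (F i) (G i)) ->
  specializes (\prod_(i <- r | P i) F i) (\prod_(i <- r | P i) G i).
Proof.
move=> FG; elim/big_ind2: _ => //; first exact: specializes1.
by move=> *; apply: specializesM.
Qed.

Lemma specializes_mmap (k : nzRingType) (h : k -> {fraction R}) (h' : k -> L)
    m (X : 'I_m -> {fraction R}) X' (p : {mpoly k[m]}) :
  (forall c, specializes (h c) (h' c)) ->
  (forall i, specializes (X i) (X' i)) ->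
  specializes (mmap h X p) (mmap h' X' p).
Proof.
move=> hh XX; apply: specializes_sum => u _; apply: specializesM => //.
apply: specializes_prod => i _; elim: (u i) => [|e IHe].
  by rewrite !expr0; apply: specializes1.
by rewrite !exprS; apply: specializesM.
Qed.

(** This is how generic nonvanishing is proved below: one nonzero specialization suffices. *)
Lemma specializes_neq0 x y : specializes x y -> y != 0 -> x != 0.
Proof.
move=> [a [b [pb -> ->]]]; rewrite mulf_eq0 negb_or => /andP[pa _].
by rewrite mulf_neq0 ?invr_eq0 ?tofrac_neq0_spec.
Qed.

Definition specializes_mx m n
    (A : 'M[{fraction R}]_(m, n)) (B : 'M[L]_(m, n)) :=
  forall i j, specializes (A i j) (B i j).

Lemma specializes_mulmx m n p (A : 'M_(m, n)) B (A' : 'M_(n, p)) B' :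
  specializes_mx A B -> specializes_mx A' B' ->
  specializes_mx (A *m A') (B *m B').
Proof.
move=> AB AB' i j; rewrite !mxE.
by apply: specializes_sum => l _; apply: specializesM.
Qed.

Lemma specializes_scalemx m n x y (A : 'M_(m, n)) B :
  specializes x y -> specializes_mx A B -> specializes_mx (x *: A) (y *: B).
Proof. by move=> xy AB i j; rewrite !mxE; apply: specializesM. Qed.

Lemma specializes_summx m n I (r : seq I) (A : I -> 'M_(m, n)) B :
  (forall i, specializes_mx (A i) (B i)) ->
  specializes_mx (\sum_(i <- r) A i) (\sum_(i <- r) B i).
Proof.
by move=> AB i j; rewrite !summxE; apply: specializes_sum => l _; apply: AB.
Qed.

Lemma specializes_tr n (A : 'M_n) B :
  specializes_mx A B -> specializes (\tr A) (\tr B).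
Proof. by move=> AB; apply: specializes_sum. Qed.

Lemma specializes_trmx m n (A : 'M_(m, n)) B :
  specializes_mx A B -> specializes_mx A^T B^T.
Proof. by move=> AB i j; rewrite !mxE. Qed.

Lemma specializes_sign e : specializes ((-1) ^+ e) ((-1) ^+ e).
Proof.
by have := specializes_tofrac ((-1) ^+ e); rewrite !rmorphXn !rmorphN1.
Qed.

Lemma specializes_det n (A : 'M_n) B :
  specializes_mx A B -> specializes (\det A) (\det B).
Proof.
move=> AB; apply: specializes_sum => s _; apply: specializesM.
  exact: specializes_sign.
exact: specializes_prod.
Qed.

Lemma specializes_unitmx n (A : 'M_n) B :
  specializes_mx A B -> B \in unitmx -> A \in unitmx.
Proof.
move=> /specializes_det AB; rewrite !unitmxE !unitfE.
exact: specializes_neq0.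
Qed.

(** The entries of the inverse are cofactors over the determinant, and the determinant has a nonzero
    value at [phi]. *)
Lemma specializes_invmx n (A : 'M_n) B :
  specializes_mx A B -> B \in unitmx -> specializes_mx (invmx A) (invmx B).
Proof.
move=> AB uB; have uA := specializes_unitmx AB uB.
rewrite /invmx uA uB; apply: specializes_scalemx.
  by apply: specializesV; [apply: specializes_det | rewrite -unitfE -unitmxE].
move=> i j; rewrite !mxE; apply: specializesM; first exact: specializes_sign.
by apply: specializes_det => u v; rewrite !mxE.
Qed.

End Specialization.

(** * Structure constants and the canonical frame *)

Section Tensors.

Variables (R : comNzRingType) (n : nat).
Implicit Types (C : {ffun 'I_n -> 'M[R]_n}) (P Q : 'M[R]_n) (w : 'rV[R]_n).

Definition coord C (t : Idx n) : R := let: (i, j, l) := t in C i j l.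

(* Vectors are rows: [lmulmx C w] is the matrix of v |-> w v, acting on the
   right, for the product e_i e_j = row j (C i). *)
Definition lmulmx C w : 'M[R]_n := \sum_a w 0 a *: C a.

(* Structure constants in the basis formed by the rows of P; Q stands for the
   inverse of P, kept separate so that the formula is polynomial. *)
Definition base_change P Q C : {ffun 'I_n -> 'M[R]_n} :=
  [ffun i => P *m lmulmx C (row i P) *m Q].

Definition trace_form C : 'cV[R]_n := \col_i \tr (C i).

(** Gram matrix of (u, v) |-> a(uv): the entry (i, j) is a(e_i e_j). *)
Definition bilin_form C : 'M[R]_n := \matrix_i (C i *m trace_form C)^T.

Lemma mul_bilin_form C w :
  w *m bilin_form C = (lmulmx C w *m trace_form C)^T.
Proof.
rewrite mulmx_sum_row /lmulmx mulmx_suml raddf_sum /=.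
by apply: eq_bigr => a _; rewrite rowK -scalemxAl linearZ.
Qed.

Lemma lmulmx_base_change P Q C w :
  lmulmx (base_change P Q C) w = P *m lmulmx C (w *m P) *m Q.
Proof.
rewrite /lmulmx; under eq_bigr do rewrite ffunE scalemxAl scalemxAr.
rewrite -mulmx_suml -mulmx_sumr; congr (_ *m _ *m _).
under eq_bigr do rewrite scaler_sumr.
rewrite exchange_big; apply: eq_bigr => a _ /=; rewrite mxE scaler_suml.
by apply: eq_bigr => b _; rewrite scalerA mxE.
Qed.

Lemma base_change_comp P Q P' Q' C :
  base_change P' Q' (base_change P Q C) = base_change (P' *m P) (Q *m Q') C.
Proof.
by apply/ffunP=> i; rewrite !ffunE lmulmx_base_change row_mul !mulmxA.
Qed.

Lemma base_change1 C : base_change 1%:M 1%:M C = C.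
Proof.
apply/ffunP=> i; rewrite ffunE mulmx1 mul1mx row1 /lmulmx (bigD1 i) //= big1.
  by rewrite mxE !eqxx scale1r addr0.
by move=> a /negPf ai; rewrite mxE ai andbF scale0r.
Qed.

Lemma trace_form_base_change P Q C : Q *m P = 1%:M ->
  trace_form (base_change P Q C) = P *m trace_form C.
Proof.
move=> QP; apply/colP=> i; rewrite !mxE ffunE mxtrace_mulC mulmxA QP mul1mx.
rewrite /lmulmx raddf_sum; apply: eq_bigr => a _.
by rewrite /= mxtraceZ !mxE.
Qed.

Lemma bilin_form_base_change P Q C : Q *m P = 1%:M ->
  bilin_form (base_change P Q C) = P *m bilin_form C *m P^T.
Proof.
move=> QP; apply/row_matrixP=> i; rewrite rowK !row_mul mul_bilin_form.
rewrite ffunE trace_form_base_change // -trmx_mul !mulmxA.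
by rewrite -(mulmxA _ Q) QP mulmx1.
Qed.

End Tensors.

Section Frames.

Variables (F : fieldType) (n : nat).
Implicit Types (C : {ffun 'I_n -> 'M[F]_n}) (P : 'M[F]_n).

(** The condition a(wv) = a(v) for all v reads [w *m bilin_form C = (trace_form C)^T]. *)
Definition wvec C : 'rV[F]_n := (trace_form C)^T *m invmx (bilin_form C).

Definition frame C : 'M[F]_n :=
  \matrix_i iter i (mulmxr (lmulmx C (wvec C))) (wvec C).

Definition normal_form C := base_change (frame C) (invmx (frame C)) C.

(** Both sides solve the same linear system, whose matrix, the transformed Gram matrix, is
    invertible. *)
Lemma wvec_base_change P C : P \in unitmx -> bilin_form C \in unitmx ->
  wvec (base_change P (invmx P) C) = wvec C *m invmx P.
Proof.
move=> uP uB; have uPT : P^T \in unitmx by rewrite unitmx_tr.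
rewrite /wvec trace_form_base_change ?bilin_form_base_change ?mulVmx //.
apply: (can_inj (mulmxK (_ : P *m bilin_form C *m P^T \in unitmx))).
  by rewrite !unitmx_mul uP uB.
rewrite mulmxKV ?unitmx_mul ?uP ?uB // trmx_mul.
by rewrite !mulmxA (mulmxKV uP) (mulmxKV uB).
Qed.

Lemma bilin_form_base_change_unit P C :
    P \in unitmx -> bilin_form C \in unitmx ->
  bilin_form (base_change P (invmx P) C) \in unitmx.
Proof.
move=> uP uB; rewrite bilin_form_base_change ?mulVmx // !unitmx_mul unitmx_tr.
by rewrite uP uB.
Qed.

Lemma frame_base_change P C : P \in unitmx -> bilin_form C \in unitmx ->
  frame (base_change P (invmx P) C) = frame C *m invmx P.
Proof.
move=> uP uB; apply/row_matrixP=> i; rewrite row_mul !rowK.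
rewrite lmulmx_base_change wvec_base_change // (mulmxKV uP).
elim: (i : nat) => // j IHj.
by rewrite !iterS IHj /= !mulmxA (mulmxKV uP).
Qed.

Lemma frame_base_change_unit P C :
    P \in unitmx -> bilin_form C \in unitmx -> frame C \in unitmx ->
  frame (base_change P (invmx P) C) \in unitmx.
Proof.
by move=> uP uB uF; rewrite frame_base_change // unitmx_mul uF unitmx_inv.
Qed.

(** The frame is multiplied by the inverse of [P], which cancels the base change by [P]. This is the
    source of all invariants below. *)
Lemma normal_form_base_change P C :
    P \in unitmx -> bilin_form C \in unitmx -> frame C \in unitmx ->
  normal_form (base_change P (invmx P) C) = normal_form C.
Proof.
move=> uP uB uF; rewrite /normal_form frame_base_change //.
rewrite base_change_comp (mulmxKV uP); congr base_change.
rewrite -[RHS](mulmxK (_ : frame C *m invmx P \in unitmx)); last first.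
  by rewrite unitmx_mul uF unitmx_inv.
by rewrite mulmxA (mulVmx uF) mul1mx.
Qed.

Lemma base_change_frame_inv C : frame C \in unitmx ->
  base_change (invmx (frame C)) (invmx (invmx (frame C))) (normal_form C) = C.
Proof.
by move=> uF; rewrite base_change_comp invmxK mulVmx // base_change1.
Qed.

Lemma base_change_normal_form P C : P \in unitmx -> frame C \in unitmx ->
  base_change P (invmx P) (normal_form C) =
  base_change (P *m frame C) (invmx (P *m frame C)) C.
Proof.
move=> uP uF; have uPF : P *m frame C \in unitmx by rewrite unitmx_mul uP uF.
rewrite base_change_comp; congr base_change.
apply: (can_inj (mulmxK uPF)).
by rewrite (mulVmx uPF) mulmxA (mulmxKV uP) mulVmx.
Qed.

(** Equivariance of the frame, applied to the base change by the frame itself. *)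
Lemma frame_normal_form C : bilin_form C \in unitmx -> frame C \in unitmx ->
  frame (normal_form C) = 1%:M.
Proof. by move=> uB uF; rewrite frame_base_change // mulmxV. Qed.

End Frames.

Lemma ord_neq_max (m : nat) (j : 'I_m.+1) : j != ord_max -> (j.+1 < m.+1)%N.
Proof.
by rewrite -val_eqE /= => jm; rewrite ltnS ltn_neqAle jm -ltnS ltn_ord.
Qed.

(** * Normal forms *)

Section Slice.

Variable m : nat.

(** The excluded coordinates are those solved for: all of e_1 e_j for j < n, the first coordinate of
    e_1 e_n (coordinate sum 1), and the last coordinate of e_i e_n for i > 1 (equal traces). *)
Definition free_coord (t : Idx m.+1) : bool :=
  let: (i, j, l) := t in
  if i == ord0 then (j == ord_max) && (l != ord0)
  else ~~ ((j == ord_max) && (l == ord_max)).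

Lemma card_free_coord : #|free_coord| = (m.+1 ^ 3 - m.+1 ^ 2)%N.
Proof.
(* The additive form avoids truncated subtraction. *)
have E : (#|free_coord| + m.+1 ^ 2 = m.+1 ^ 3)%N; last by rewrite -E addnK.
have -> : #|free_coord| = (\sum_i \sum_j \sum_l free_coord (i, j, l))%N.
  rewrite -sum1_card big_mkcond /= pair_bigA pair_bigA /=.
  by apply: eq_bigr => -[[i j] l] _; rewrite unfold_in; case: (free_coord _).
have S1 (i : 'I_m.+1) : (\sum_(l < m.+1) (l != i) = m)%N.
  transitivity #|predC1 i|; last by rewrite cardC1 card_ord.
  rewrite -sum1_card [RHS]big_mkcond; apply: eq_bigr => l _.
  by rewrite inE; case: (l != i).
have S0 : (\sum_j \sum_l free_coord (ord0, j, l) = m)%N.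
  rewrite (bigD1 ord_max) //= eqxx S1 big1 ?addn0 // => j /negPf ->.
  by rewrite big1.
have Si (i : 'I_m.+1) : i != ord0 ->
    (\sum_j \sum_l free_coord (i, j, l) = m + m * m.+1)%N.
  move=> /negPf i0; rewrite (bigD1 ord_max) //= i0 eqxx S1; congr addn.
  rewrite (eq_bigr (fun=> m.+1)) => [|j /negPf ->].
    by rewrite sum_nat_const cardC1 card_ord.
  by rewrite sum1_card card_ord.
rewrite (bigD1 ord0) //= S0 (eq_bigr _ Si) sum_nat_const cardC1 card_ord /=.
rewrite !expnS expn0; lia.
Qed.

Section SliceRing.

Variable R : comNzRingType.
Implicit Types (s : Idx m.+1 -> R).

(** Matrix of left multiplication by e_1: a shift, completed by a last row with sum 1. *)
Definition slice0 s : 'M[R]_m.+1 :=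
  \matrix_(j, l) if j == ord_max then
                   if l == ord0
                   then 1 - \sum_(l' | l' != ord0) s (ord0, ord_max, l')
                   else s (ord0, ord_max, l)
                 else (l == j.+1 :> nat)%:R.

(** For i > 1 the lower right corner of the matrix of L_(e_i) is adjusted to make its trace equal to
    that of L_(e_1), which is the corner of [slice0 s]. *)
Definition slice s : {ffun 'I_m.+1 -> 'M[R]_m.+1} :=
  [ffun i => if i == ord0 then slice0 s else
    \matrix_(j, l) if (j == ord_max) && (l == ord_max)
                   then slice0 s ord_max ord_max
                        - \sum_(j' | j' != ord_max) s (i, j', j')
                   else s (i, j, l)].

Lemma eq_slice s s' : (forall t, free_coord t -> s t = s' t) ->
  slice s = slice s'.
Proof.
move=> ss'; have e0 : slice0 s = slice0 s'.
  apply/matrixP=> j l; rewrite !mxE; case: eqP => // _.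
  have e l' : l' != ord0 -> s (ord0, ord_max, l') = s' (ord0, ord_max, l').
    by move=> l'0; apply: ss'; rewrite /= !eqxx.
  by rewrite (eq_bigr _ e); case: eqP => // /eqP /e.
apply/ffunP=> i; rewrite !ffunE e0; case: eqP => // /eqP/negPf i0.
apply/matrixP=> j l; rewrite !mxE; case: ifP => [_|jl].
  congr (_ - _); apply: eq_bigr => j' /negPf jm.
  by apply: ss'; rewrite /= i0 jm.
by apply: ss'; rewrite /= i0 jl.
Qed.

Lemma coord_slice s t : free_coord t -> coord (slice s) t = s t.
Proof.
case: t => [[i j] l] /=; rewrite ffunE.
case: eqP => [-> /andP[/eqP -> /negPf l0]|_ /negPf jl].
  by rewrite mxE eqxx l0.
by rewrite mxE jl.
Qed.

Lemma mxtrace_slice s i : \tr (slice s i) = slice0 s ord_max ord_max.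
Proof.
rewrite /mxtrace (bigD1 ord_max) //= ffunE.
case: eqP => _.
  rewrite big1 ?addr0 // => j /negPf jm.
  by rewrite mxE jm -[_ == j.+1 :> nat]/(j == j.+1 :> nat) ltn_eqF.
rewrite mxE !eqxx /= -[RHS](subrK (\sum_(j | j != ord_max) s (i, j, j))).
by congr (_ + _); apply: eq_bigr => j /negPf jm; rewrite mxE jm.
Qed.

Lemma trace_form_slice s :
  trace_form (slice s) = const_mx (slice0 s ord_max ord_max).
Proof. by apply/colP=> i; rewrite mxE [RHS]mxE mxtrace_slice. Qed.

Lemma row_slice0 s (j : 'I_m.+1) (jm : (j.+1 < m.+1)%N) :
  row j (slice0 s) = delta_mx 0 (Ordinal jm).
Proof.
apply/rowP=> l; rewrite !mxE eqxx /=; case: eqP => // jmax.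
by exfalso; move: (jm); rewrite jmax /= ltnn.
Qed.

(** Every row of [slice0 s] sums to 1. *)
Lemma slice0_const s a : slice0 s *m const_mx a = const_mx a :> 'cV_m.+1.
Proof.
apply/colP=> j; rewrite !mxE.
under eq_bigr do rewrite [const_mx a _ _]mxE.
rewrite -mulr_suml; have [->|jm] := eqVneq j ord_max.
  rewrite (bigD1 ord0) //= mxE !eqxx -[RHS]mul1r; congr (_ * _).
  rewrite -[RHS](subrK (\sum_(l | l != ord0) s (ord0, ord_max, l))).
  by congr (_ + _); apply: eq_bigr => l /negPf l0; rewrite mxE eqxx l0.
have jlt := ord_neq_max jm.
rewrite (bigD1 (Ordinal jlt)) //= mxE (negPf jm) /= eqxx big1 ?addr0 ?mul1r //.
by move=> l; rewrite -val_eqE /= mxE (negPf jm) => /negPf ->.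
Qed.

(** Since the trace form is constant on the basis, e_1 satisfies the equation defining w. *)
Lemma bilin_form_slice0 s :
  delta_mx 0 ord0 *m bilin_form (slice s) = (trace_form (slice s))^T.
Proof.
rewrite -rowE rowK; congr _^T.
by rewrite trace_form_slice ffunE eqxx slice0_const.
Qed.

End SliceRing.

Section SliceField.

Variable F : fieldType.

(** Nondegeneracy makes w unique, so w = e_1; the shift then produces the standard basis. *)
Lemma frame_slice (s : Idx m.+1 -> F) :
  bilin_form (slice s) \in unitmx -> frame (slice s) = 1%:M.
Proof.
move=> uB; have w0 : wvec (slice s) = delta_mx 0 ord0.
  by rewrite /wvec -bilin_form_slice0 mulmxK.
apply/row_matrixP=> i; rewrite rowK w0 row1.
have -> : lmulmx (slice s) (delta_mx 0 ord0) = slice0 s.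
  rewrite /lmulmx (bigD1 ord0) //= mxE !eqxx scale1r ffunE eqxx big1 ?addr0 //.
  by move=> a /negPf a0; rewrite mxE a0 andbF scale0r.
case: i => i; elim: i => [|i IHi] im /=; first by congr delta_mx; apply/val_inj.
by rewrite (IHi (ltnW im)) -rowE row_slice0; congr delta_mx; apply/val_inj.
Qed.

(** Converse of [frame_slice]: the equations of a normal form are recovered from w = e_1 and e_1 e_j
    = e_(j+1). *)
Lemma frame1_slice (C : {ffun 'I_m.+1 -> 'M[F]_m.+1}) :
  bilin_form C \in unitmx -> frame C = 1%:M -> C = slice (coord C).
Proof.
move=> uB F1; set a := C ord0 ord_max ord_max.
have w0 : wvec C = delta_mx 0 ord0 by rewrite -row1 -F1 rowK.
have LE : lmulmx C (wvec C) = C ord0.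
  rewrite w0 /lmulmx (bigD1 ord0) //= mxE !eqxx scale1r big1 ?addr0 //.
  by move=> b /negPf b0; rewrite mxE b0 andbF scale0r.
have rowC (j : 'I_m.+1) (jm : (j.+1 < m.+1)%N) :
    row j (C ord0) = delta_mx 0 (Ordinal jm).
  by rewrite rowE -!row1 -F1 !rowK LE.
have C0 (j l : 'I_m.+1) : j != ord_max -> C ord0 j l = (l == j.+1 :> nat)%:R.
  move=> jm; have jlt := ord_neq_max jm.
  by have /rowP/(_ l) := rowC j jlt; rewrite !mxE eqxx.
have tr0 : \tr (C ord0) = a.
  rewrite /mxtrace (bigD1 ord_max) //= big1 ?addr0 // => j /C0 ->.
  by rewrite ltn_eqF.
(* This is a(e_1 v) = a(v), the defining equation of w = e_1. *)
have CT : C ord0 *m trace_form C = trace_form C.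
  have : wvec C *m bilin_form C = (trace_form C)^T by rewrite mulmxKV.
  by rewrite mul_bilin_form LE => /trmx_inj.
(* At v = e_j with j < n the relation says that e_j and e_(j+1) have the same trace; the first trace
   is [tr0]. *)
have TE : trace_form C = const_mx a.
  apply/colP=> -[i im]; rewrite [RHS]mxE; elim: i im => [|i IHi] im.
    by rewrite mxE -tr0; congr (\tr (C _)); apply/val_inj.
  rewrite -(IHi (ltnW im)) -[in RHS]CT [RHS]mxE (bigD1 (Ordinal im)) //=.
  have j0 : Ordinal (ltnW im) != ord_max by rewrite -val_eqE /= ltn_eqF.
  rewrite (C0 _ _ j0) eqxx mul1r big1 ?addr0 // => l; rewrite -val_eqE /=.
  by rewrite (C0 _ _ j0) /= => /negPf ->; rewrite mul0r.
(* A zero trace form would give w = 0 instead of e_1. *)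
have a0 : a != 0.
  apply: contra_eq_neq w0 => a0; rewrite /wvec TE a0 trmx_const.
  rewrite (_ : const_mx 0 = 0) ?mul0mx; last by apply/rowP=> i; rewrite !mxE.
  by apply/eqP=> /rowP/(_ ord0)/eqP; rewrite !mxE !eqxx eq_sym oner_eq0.
(* The relation at v = e_n says that [a] times this sum is [a]. *)
have sum_max : \sum_l C ord0 ord_max l = 1.
  apply: (mulIf a0); rewrite mul1r mulr_suml.
  have /colP/(_ ord_max) := CT; rewrite TE !mxE => {2}<-.
  by apply: eq_bigr => l _; rewrite [const_mx a _ _]mxE.
have S0 : slice0 (coord C) = C ord0.
  apply/matrixP=> j l; rewrite mxE; case: eqP => [->|/eqP/C0 -> //].
  by case: eqP => [->|//]; rewrite -sum_max (bigD1 ord0) //= addrK.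
apply/ffunP=> i; rewrite ffunE S0; case: eqP => [->//|/eqP i0].
apply/matrixP=> j l; rewrite mxE; case: andP => [[/eqP -> /eqP ->]|//].
rewrite -/a; have /colP/(_ i) := TE; rewrite !mxE => <-.
by rewrite /mxtrace (bigD1 ord_max) //= addrK.
Qed.

(* With these parameters e_1 e_j = e_(j+1) for j < n, e_1 e_n = e_n and
   e_i e_j = [i = j] e_i for i > 1, whose bilinear form is unitriangular. *)
Definition base_point (t : Idx m.+1) : F :=
  let: (i, j, l) := t in
  if i == ord0 then (l == ord_max)%:R else ((i == j) && (j == l))%:R.

Lemma bilin_form_base_point : bilin_form (slice base_point) \in unitmx.
Proof.
have max1 : slice0 base_point ord_max ord_max = 1.
  (* In dimension one the corner is not a parameter but the dependent entry, 1 minus an empty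
     sum. *)
  rewrite mxE eqxx; case: (eqVneq ord_max ord0) => [m0|_]; last first.
    by rewrite /base_point !eqxx.
  by rewrite big1 ?subr0 // => l; rewrite /base_point eqxx -m0 => /negPf ->.
have TE := trace_form_slice base_point; rewrite max1 in TE.
have sE i j l : i != ord0 -> slice base_point i j l =
    if (j == ord_max) && (l == ord_max)
    then 1 - \sum_(j' | j' != ord_max) (i == j')%:R
    else ((i == j) && (j == l))%:R.
  move=> /negPf i0; rewrite ffunE i0 mxE max1 /base_point i0.
  congr (if _ then _ - _ else _).
  by apply: eq_bigr => j' _; rewrite eqxx andbT.
have sum_delta (j : 'I_m.+1) (P : pred 'I_m.+1) :
    \sum_(l | P l) (j == l)%:R = (P j)%:R :> F.
  have [Pj|Pj] := boolP (P j).
    rewrite (bigD1 j) //= eqxx big1 ?addr0 // => l /andP[_].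
    by rewrite eq_sym => /negPf ->.
  by rewrite big1 // => l; case: eqP => // <-; rewrite (negPf Pj).
have BE i : row i (bilin_form (slice base_point)) =
    if i == ord0 then const_mx 1 else delta_mx 0 i.
  rewrite rowK TE; case: eqP => [->|/eqP i0].
    by rewrite ffunE eqxx slice0_const trmx_const.
  apply/rowP=> j; rewrite [LHS]mxE [LHS]mxE [RHS]mxE eqxx /= [j == i]eq_sym.
  under eq_bigr do rewrite [const_mx 1 _ _]mxE mulr1 sE //.
  have [->|jm] := eqVneq j ord_max.
    rewrite (bigD1 ord_max) //= !eqxx /= sum_delta big1 => [|l /negPf lm].
      by case: eqP => _; rewrite ?subr0 ?subrr addr0.
    by rewrite lm [ord_max == l]eq_sym lm andbF.
  case: eqP => _ /=; last by rewrite big1.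
  by rewrite sum_delta.
(* The first row is all ones and the others are those of the identity: upper unitriangular, hence
   the transpose for [det_trig]. *)
rewrite unitmxE -det_tr det_trig; last first.
  apply/is_trig_mxP=> i j ij; rewrite mxE.
  have /rowP/(_ i) := BE j; rewrite mxE => ->.
  have /negPf -> : j != ord0 by rewrite -val_eqE /= -lt0n (leq_ltn_trans _ ij).
  by rewrite !mxE eqxx /= -val_eqE /= (ltn_eqF ij).
rewrite big1 ?unitr1 // => i _; rewrite mxE.
by have /rowP/(_ i) := BE i; rewrite mxE => ->; case: eqP; rewrite !mxE ?eqxx.
Qed.

End SliceField.

End Slice.

(** * Tensors under ring morphisms and specialization *)

Section MapTensors.

Variables (R S : comNzRingType) (h : {rmorphism R -> S}).

Definition map_tensor n (C : {ffun 'I_n -> 'M[R]_n}) : {ffun 'I_n -> 'M[S]_n} :=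
  [ffun i => map_mx h (C i)].

Lemma coord_map_tensor n (C : {ffun 'I_n -> 'M[R]_n}) t :
  coord (map_tensor C) t = h (coord C t).
Proof. by case: t => [[i j] l]; rewrite /coord ffunE mxE. Qed.

Lemma map_lmulmx n (C : {ffun 'I_n -> 'M[R]_n}) w :
  lmulmx (map_tensor C) (map_mx h w) = map_mx h (lmulmx C w).
Proof.
rewrite /lmulmx raddf_sum; apply: eq_bigr => a _.
by rewrite ffunE /= map_mxZ mxE.
Qed.

Lemma map_base_change n P Q (C : {ffun 'I_n -> 'M[R]_n}) :
  base_change (map_mx h P) (map_mx h Q) (map_tensor C) =
  map_tensor (base_change P Q C).
Proof. by apply/ffunP=> i; rewrite !ffunE !map_mxM -map_row map_lmulmx. Qed.

Lemma map_trace_form n (C : {ffun 'I_n -> 'M[R]_n}) :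
  trace_form (map_tensor C) = map_mx h (trace_form C).
Proof. by apply/colP=> i; rewrite !mxE ffunE trace_map_mx. Qed.

Lemma map_bilin_form n (C : {ffun 'I_n -> 'M[R]_n}) :
  bilin_form (map_tensor C) = map_mx h (bilin_form C).
Proof.
apply/row_matrixP=> i; rewrite -map_row !rowK map_trace_form ffunE.
by rewrite -map_mxM map_trmx.
Qed.

(** The dependent coordinates are polynomials in the free ones with integer coefficients. *)
Lemma map_slice m (s : Idx m.+1 -> R) :
  map_tensor (slice s) = slice (h \o s).
Proof.
have S0 : map_mx h (slice0 s) = slice0 (h \o s).
  apply/matrixP=> j l; rewrite !mxE.
  by do 2?[case: eqP => _] => //;
    rewrite ?rmorph_nat // rmorphB rmorph1 rmorph_sum.
apply/ffunP=> i; rewrite !ffunE; case: eqP => _ //.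
apply/matrixP=> j l; rewrite mxE [X in h X]mxE [RHS]mxE -S0.
case: ifP => _ //; rewrite rmorphB rmorph_sum; congr (_ - _).
by rewrite [RHS]mxE.
Qed.

End MapTensors.

Section SpecializeTensors.

Variables (R : idomainType) (L : fieldType).
Variables (phi : {rmorphism R -> L}) (n : nat).
Implicit Types (C : {ffun 'I_n -> 'M[{fraction R}]_n}).
Implicit Types (D : {ffun 'I_n -> 'M[L]_n}).

Definition specializes_tensor C D := forall i, specializes_mx phi (C i) (D i).

Lemma specializes_coord C D t :
  specializes_tensor C D -> specializes phi (coord C t) (coord D t).
Proof. by case: t => [[i j] l] CD; apply: CD. Qed.

Lemma specializes_lmulmx C D w w' : specializes_tensor C D ->
  specializes_mx phi w w' -> specializes_mx phi (lmulmx C w) (lmulmx D w').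
Proof.
by move=> CD ww'; apply: specializes_summx => i; apply: specializes_scalemx.
Qed.

Lemma specializes_base_change C D P Q P' Q' : specializes_tensor C D ->
    specializes_mx phi P P' -> specializes_mx phi Q Q' ->
  specializes_tensor (base_change P Q C) (base_change P' Q' D).
Proof.
move=> CD PP QQ i; rewrite !ffunE; apply: specializes_mulmx => //.
apply: specializes_mulmx => //; apply: specializes_lmulmx => // u v.
by rewrite !mxE.
Qed.

Lemma specializes_trace_form C D : specializes_tensor C D ->
  specializes_mx phi (trace_form C) (trace_form D).
Proof. by move=> CD i j; rewrite !mxE; apply: specializes_tr. Qed.

Lemma specializes_bilin_form C D : specializes_tensor C D ->
  specializes_mx phi (bilin_form C) (bilin_form D).
Proof.
move=> CD i j; rewrite mxE [bilin_form D i j]mxE; apply: specializes_trmx.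
by apply: specializes_mulmx => //; apply: specializes_trace_form.
Qed.

Lemma specializes_wvec C D : specializes_tensor C D ->
  bilin_form D \in unitmx -> specializes_mx phi (wvec C) (wvec D).
Proof.
move=> CD uB; apply: specializes_mulmx.
  exact/specializes_trmx/specializes_trace_form.
exact/specializes_invmx/uB/specializes_bilin_form.
Qed.

Lemma specializes_frame C D : specializes_tensor C D ->
  bilin_form D \in unitmx -> specializes_mx phi (frame C) (frame D).
Proof.
move=> CD uB i j; have ww := specializes_wvec CD uB.
rewrite mxE [frame D i j]mxE; move: 0 j.
elim: (i : nat) => //= e IHe; apply: specializes_mulmx => //.
exact: specializes_lmulmx.
Qed.

Lemma specializes_normal_form C D : specializes_tensor C D ->
    bilin_form D \in unitmx -> frame D \in unitmx ->
  specializes_tensor (normal_form C) (normal_form D).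
Proof.
move=> CD uB uF; have FF := specializes_frame CD uB.
exact: specializes_base_change (specializes_invmx FF uF).
Qed.

(** Applied with [D] the generic tensor and [phi] the pullback by a group element, this says that
    the normal form is unchanged by the group. *)
Lemma specializes_normal_form_base_change C D P :
    P \in unitmx -> bilin_form D \in unitmx -> frame D \in unitmx ->
    specializes_tensor C (base_change P (invmx P) D) ->
  specializes_tensor (normal_form C) (normal_form D).
Proof.
move=> uP uB uF CD; rewrite -(normal_form_base_change uP uB uF).
apply: specializes_normal_form => //.
  exact: bilin_form_base_change_unit.
exact: frame_base_change_unit.
Qed.

End SpecializeTensors.

(** * Evaluation of multivariate polynomials *)

Lemma rmorph_mmap (N : nat) (R S T : comNzRingType) (g : {rmorphism S -> T})
    (f : R -> S) (h : 'I_N -> S) (p : {mpoly R[N]}) :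
  g (mmap f h p) = mmap (g \o f) (g \o h) p.
Proof.
rewrite rmorph_sum; apply: eq_bigr => u _; rewrite rmorphM rmorph_prod.
by congr (_ * _); apply: eq_bigr => i _; rewrite rmorphXn.
Qed.

Lemma mmap_ext (N : nat) (R S : nzRingType) (f f' : R -> S) (h h' : 'I_N -> S)
    (p : {mpoly R[N]}) : f =1 f' -> h =1 h' -> mmap f h p = mmap f' h' p.
Proof. by move=> ff hh; apply: eq_bigr => u _; rewrite ff (mmap1_eq _ hh). Qed.

Lemma mmap_id (N : nat) (R : nzRingType) (p : {mpoly R[N]}) :
  mmap (@mpolyC N R) (fun i => 'X_i) p = p.
Proof.
rewrite [RHS]mpolyE; apply: eq_bigr => u _.
by rewrite mmap1_id mul_mpolyC.
Qed.

Lemma specializes_mpolyC (K : fieldType) (N : nat) (v : 'I_N -> K) a :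
  specializes (meval v) a%:MP%:F a.
Proof.
by rewrite -[X in specializes _ _ X](mevalC v); apply: specializes_tofrac.
Qed.

(** * Density of GL_n(k) in GL_n(K) *)

Section GLDensity.

Variables (k K : fieldType) (iota : {rmorphism k -> K}) (n : nat).
Hypothesis kinf : forall s : seq k, exists x, x \notin s.

Local Notation N := #|{: 'I_n * 'I_n}|.

Definition mx_point (P : 'M[K]_n) (i : 'I_N) : K :=
  P (enum_val i).1 (enum_val i).2.

Definition generic_mx : 'M[{fraction {mpoly K[N]}}]_n :=
  \matrix_(i, j) ('X_(enum_rank (i, j)))%:F.

Lemma specializes_generic_mx P :
  specializes_mx (meval (mx_point P)) generic_mx P.
Proof.
move=> i j; rewrite mxE -[P i j](_ : ('X_(enum_rank (i, j))).@[mx_point P] = _).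
  exact: specializes_tofrac.
by rewrite mevalXU /mx_point enum_rankK.
Qed.

(** Write [x] as [a / b] and the generic determinant as [c / e]. The four polynomials are nonzero,
    so at some k-point none of them vanishes; there the matrix is invertible and [X] is nonzero. *)
Lemma GL_dense (x : {fraction {mpoly K[N]}}) (X : 'M[K]_n -> K) P0 :
    (forall P, P \in unitmx -> specializes (meval (mx_point P)) x (X P)) ->
    P0 \in unitmx -> X P0 != 0 ->
  exists2 P : 'M[k]_n, P \in unitmx & X (map_mx iota P) != 0.
Proof.
move=> xX uP0 X0; have [a [b [b0 xE _]]] := xX _ uP0.
have [c [e [e0 dE _]]] :=
  specializes_det (specializes_generic_mx (1%:M : 'M[K]_n)).
have x_neq0 := specializes_neq0 (xX _ uP0) X0.
have d_neq0 : \det generic_mx != 0.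
  have := specializes_det (specializes_generic_mx (1%:M : 'M[K]_n)).
  by move/specializes_neq0; apply; rewrite det1 oner_eq0.
have nz (R : idomainType) (u v : R) : u%:F / v%:F != 0 -> u * v != 0.
  by rewrite !mulf_eq0 invr_eq0 !tofrac_eq0.
have ab0 := nz _ a b (etrans (congr1 (fun y => y != 0) (esym xE)) x_neq0).
have ce0 := nz _ c e (etrans (congr1 (fun y => y != 0) (esym dE)) d_neq0).
have abce := mulf_neq0 ab0 ce0.
have [v] := mpoly_nonzero_point iota kinf abce.
pose P : 'M[k]_n := \matrix_(i, j) v (enum_rank (i, j)).
have -> : (a * b * (c * e)).@[iota \o v] =
          (a * b * (c * e)).@[mx_point (map_mx iota P)].
  by apply: meval_eq => i; rewrite /mx_point !mxE -surjective_pairing enum_valK.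
rewrite !rmorphM !mulf_eq0 !negb_or => /andP[/andP[av bv] /andP[cv ev]].
have uP : map_mx iota P \in unitmx.
  rewrite unitmxE unitfE.
  rewrite (specializesP (specializes_det (specializes_generic_mx _)) ev dE).
  by rewrite mulf_neq0 ?invr_eq0.
exists P; first by rewrite -(map_unitmx iota).
by rewrite (specializesP (xX _ uP) bv xE) mulf_neq0 ?invr_eq0.
Qed.

End GLDensity.

(** * The generic multiplication and the group action *)

HB.instance Definition _ (k : fieldType) (n : nat) :=
  GRing.RMorphism.copy (@constR k n) (@FracField.tofrac _ \o @mpolyC (Nc n) k).

Section GenericTensor.

Variables (k : fieldType) (n : nat).

Definition generic_tensor : {ffun 'I_n -> 'M[RatM k n]_n} :=
  [ffun i => \matrix_(j, l) (coordM k (i, j, l))%:F].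

Definition tensor_point (R : comNzRingType) (C : {ffun 'I_n -> 'M[R]_n})
    (s : 'I_(Nc n)) : R := coord C (enum_val s).

Lemma specializes_generic_tensor (L : fieldType)
    (phi : {rmorphism PolM k n -> L}) (D : {ffun 'I_n -> 'M[L]_n}) :
  (forall t, phi (coordM k t) = coord D t) ->
  specializes_tensor phi generic_tensor D.
Proof.
move=> phiD i j l; rewrite ffunE mxE.
rewrite -[D i j l](phiD (i, j, l)); exact: specializes_tofrac.
Qed.

Lemma mmap_generic_tensor (p : PolM k n) :
  mmap (@constR k n) (tensor_point generic_tensor) p = p%:F.
Proof.
rewrite -[in RHS](mmap_id p) rmorph_mmap; apply: mmap_ext => // s.
rewrite /tensor_point /= -[in RHS](enum_valK s).
case: (enum_val s) => [[i j] l].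
by rewrite /coord ffunE mxE.
Qed.

(** The structure constants of g.mu are those of mu in the basis of the g^-1 e_i. These are the
    columns of g^-1, while basis vectors are rows here, hence the transposes. *)
Lemma act_coordE (g : 'M[k]_n) (t : Idx n) :
  (act_coord g t)%:F =
  coord (base_change (map_mx (@constR k n) (invmx g)^T)
                     (map_mx (@constR k n) g^T) generic_tensor) t.
Proof.
case: t => [[i j] l]; rewrite /act_coord /coord ffunE.
rewrite /lmulmx mulmx_sumr mulmx_suml summxE rmorph_sum.
apply: eq_bigr => a _.
rewrite -scalemxAr -scalemxAl !mxE exchange_big rmorph_sum.
rewrite mulr_sumr; apply: eq_bigr => c _; rewrite !mxE rmorph_sum.
rewrite mulr_suml mulr_sumr; apply: eq_bigr => b _.
rewrite !mxE ffunE mxE -mul_mpolyC rmorphM !mpolyCM !rmorphM /= /constR.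
by ring.
Qed.

Lemma tofrac_pullback (g : 'M[k]_n) (p : PolM k n) :
  (pullback g p)%:F =
  mmap (@constR k n) (tensor_point
    (base_change (map_mx (@constR k n) (invmx g)^T)
                 (map_mx (@constR k n) g^T) generic_tensor)) p.
Proof.
rewrite /pullback rmorph_mmap; apply: mmap_ext => // s /=.
by rewrite act_coordE.
Qed.

End GenericTensor.

(** * The invariant field *)

Section InvariantField.

Variables (k : fieldType) (m : nat).
Hypothesis kinf : forall s : seq k, exists x, x \notin s.

Local Notation n := m.+1.
Local Notation K := (RatM k n).
Local Notation c := (@constR k n).
Local Notation G := (generic_tensor k n).
Local Notation N := #|@free_coord m|.
Local Notation NF := (normal_form G).

(* Coordinates that are not free get the junk value 0, which [slice] ignores. *)
Definition extend (R : comNzRingType) (v : 'I_N -> R) (t : Idx n) : R :=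
  oapp v 0 [pick i | enum_val i == t].

Lemma extend_enum_val (R : comNzRingType) (v : 'I_N -> R) i :
  extend v (enum_val i) = v i.
Proof.
rewrite /extend; case: pickP => [j /eqP/enum_val_inj -> //|/(_ i)].
by rewrite eqxx.
Qed.

Lemma free_coordP t : free_coord t -> exists i : 'I_N, t = enum_val i.
Proof.
by move=> ft; exists (enum_rank_in ft t); rewrite enum_rankK_in.
Qed.

Lemma map_slice_extend (R S : comNzRingType) (h : {rmorphism R -> S})
    (v : 'I_N -> R) :
  map_tensor h (slice (extend v)) = slice (extend (h \o v)).
Proof.
rewrite map_slice; apply: eq_slice => t /free_coordP[i ->].
by rewrite /= !extend_enum_val.
Qed.

Lemma specializes_eval_at (D : {ffun 'I_n -> 'M[k]_n}) :
  specializes_tensor (meval (tensor_point D)) G D.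
Proof.
apply: specializes_generic_tensor => t.
by rewrite [LHS]mevalXU /tensor_point enum_rankK.
Qed.

Lemma normal_form_slice (s : Idx n -> k) :
  bilin_form (slice s) \in unitmx -> normal_form (slice s) = slice s.
Proof.
by move=> uB; rewrite /normal_form frame_slice // invmx1 base_change1.
Qed.

Lemma specializes_normal_form_slice (s : Idx n -> k) :
  bilin_form (slice s) \in unitmx ->
  specializes_tensor (meval (tensor_point (slice s))) NF (slice s).
Proof.
move=> uB; rewrite -[X in specializes_tensor _ _ X]normal_form_slice //.
apply: specializes_normal_form => //; first exact: specializes_eval_at.
by rewrite frame_slice ?unitmx1.
Qed.

Lemma generic_bilin_form_unit : bilin_form G \in unitmx.
Proof.
apply: specializes_unitmx (bilin_form_base_point m k).
exact/specializes_bilin_form/specializes_eval_at.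
Qed.

Lemma generic_frame_unit : frame G \in unitmx.
Proof.
have uB := bilin_form_base_point m k.
apply: specializes_unitmx (specializes_frame (specializes_eval_at _) uB) _.
by rewrite frame_slice ?unitmx1.
Qed.

Let uB := generic_bilin_form_unit.
Let uF := generic_frame_unit.

(** The generic normal form has frame 1, so it lies on the slice and is determined by its free
    coordinates. *)
Lemma normal_form_generic_slice :
  NF = slice (extend (fun i : 'I_N => coord NF (enum_val i))).
Proof.
have uBN : bilin_form NF \in unitmx := bilin_form_base_change_unit uF uB.
rewrite {1}(frame1_slice uBN (frame_normal_form uB uF)).
by apply: eq_slice => t /free_coordP[i ->]; rewrite extend_enum_val.
Qed.

Lemma normal_form_coord_invariant t : Defs.invariant (coord NF t).
Proof.
have uBs := bilin_form_base_point m k.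
have [a [b [pb fE _]]] :=
  specializes_coord t (specializes_normal_form_slice uBs).
have b0 : b != 0 by rewrite -tofrac_eq0 (tofrac_neq0_spec pb).
exists a, b; split=> //; split=> // g ug.
pose h (s : 'I_(Nc n)) := act_coord g (enum_val s).
(* Pullback by [g], seen as a K-valued point of the space of multiplications; it sends the generic
   tensor to its base change by [P]. *)
pose phi : {rmorphism PolM k n -> K} :=
  @FracField.tofrac _ \o mmap (@mpolyC (Nc n) k) h.
pose P := map_mx c (invmx g)^T.
have uP : P \in unitmx by rewrite map_unitmx unitmx_tr unitmx_inv.
have PE : map_mx c g^T = invmx P.
  by rewrite /P -map_invmx -trmx_inv invmxK.
have spG : specializes_tensor phi G (base_change P (invmx P) G).
  apply: specializes_generic_tensor => t'; rewrite -PE -act_coordE /phi /=.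
  by rewrite mmapX mmap1U /h enum_rankK.
have spNF := specializes_normal_form_base_change uP uB uF spG.
(* The coordinate specializes to itself along [phi]. The fraction [a' / b'] witnessing this depends
   on [g], so the identity is carried over to the fixed [a / b] by cross multiplication. *)
have [a' [b' [pb' fE' gfE]]] := specializes_coord t spNF.
have {}pb' : pullback g b' != 0 by rewrite -tofrac_eq0.
have b'0 : b' != 0.
  by apply: contraNneq pb' => ->; rewrite /pullback rmorph0.
have e1 : a * b' = a' * b.
  apply/eqP; rewrite -tofrac_eq !tofracM -eqr_div ?tofrac_eq0 //.
  by rewrite -fE -fE'.
have e2 : a' * pullback g b' = pullback g a' * b'.
  apply/eqP; rewrite -tofrac_eq !tofracM -eqr_div ?tofrac_eq0 //.
  by rewrite -fE' gfE.
have e3 : pullback g a * pullback g b' = pullback g a' * pullback g b.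
  by rewrite /pullback -!rmorphM e1.
apply: (mulIf (mulf_neq0 b'0 pb')).
transitivity (pullback g a * pullback g b' * (b * b')); first by ring.
rewrite e3; transitivity (pullback g a' * b' * (pullback g b * b)).
  by ring.
rewrite -e2; transitivity (a' * b * (pullback g b * pullback g b')).
  by ring.
by rewrite -e1; ring.
Qed.

(** On the slice the free coordinates of the normal form are the parameters themselves. At a
    nondegenerate slice point where [P] is nonzero, the evaluated [P] specializes to that nonzero
    value. *)
Lemma normal_form_alg_indep :
  alg_indep (fun i : 'I_N => coord NF (enum_val i)).
Proof.
move=> P P0.
(* The universal slice point: its Gram determinant is a polynomial in the parameters, nonzero
   because of the base point. *)
pose D : {ffun 'I_n -> 'M[{mpoly k[N]}]_n} := slice (extend (fun i => 'X_i)).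
have DE (v : 'I_N -> k) : map_tensor (meval v) D = slice (extend v).
  rewrite map_slice_extend; apply: eq_slice => t /free_coordP[i ->].
  by rewrite !extend_enum_val /= mevalXU.
have detE v : (\det (bilin_form D)).@[v] = \det (bilin_form (slice (extend v))).
  by rewrite -DE map_bilin_form det_map_mx.
have D0 : \det (bilin_form D) != 0.
  apply: contraTneq (bilin_form_base_point m k) => D0.
  have <- : slice (extend (fun i => base_point k (enum_val i))) =
            slice (base_point (m := m) k).
    by apply: eq_slice => t /free_coordP[i ->]; rewrite extend_enum_val.
  by rewrite unitmxE unitfE negbK -detE D0 meval0.
have [v] := mpoly_nonzero_point idfun kinf (mulf_neq0 P0 D0).
rewrite mevalM mulf_eq0 negb_or detE => /andP[Pv uBv].
rewrite -unitfE -unitmxE in uBv.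
apply: (specializes_neq0 (phi := meval (tensor_point (slice (extend v))))) Pv.
apply: specializes_mmap => [a|i]; first exact: specializes_mpolyC.
rewrite /= -(extend_enum_val v i) -(coord_slice (R := k)); last first.
  exact: enum_valP.
exact/specializes_coord/specializes_normal_form_slice.
Qed.

Definition eval_tensor (p : PolM k n) (D : {ffun 'I_n -> 'M[K]_n}) : K :=
  mmap c (tensor_point D) p.

(** The value of [p] on the base change of [D] by a generic matrix, as a rational function of the
    matrix entries. *)
Definition generic_eval (D : {ffun 'I_n -> 'M[K]_n}) (p : PolM k n) :
    {fraction {mpoly K[#|{: 'I_n * 'I_n}|]}} :=
  mmap (fun a => (c a)%:MP%:F)
    (tensor_point (base_change (generic_mx K n) (invmx (generic_mx K n))
                     [ffun i => map_mx (fun a => a%:MP%:F) (D i)])) p.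

Lemma specializes_generic_eval (D : {ffun 'I_n -> 'M[K]_n}) P p :
  P \in unitmx ->
  specializes (meval (mx_point P)) (generic_eval D p)
    (eval_tensor p (base_change P (invmx P) D)).
Proof.
move=> uP; have ZP := specializes_generic_mx P.
apply: specializes_mmap => [a|s]; first exact: specializes_mpolyC.
apply: specializes_coord.
apply: specializes_base_change => //; last exact: specializes_invmx.
by move=> i j l; rewrite ffunE mxE; apply: specializes_mpolyC.
Qed.

Lemma invariant_base_change (p q : PolM k n) :
    (forall g : 'M[k]_n, g \in unitmx ->
       pullback g p * q = p * pullback g q) ->
  forall P : 'M[K]_n, P \in unitmx ->
    eval_tensor p (base_change P (invmx P) G) * q%:F =
    p%:F * eval_tensor q (base_change P (invmx P) G).
Proof.
(* The identity holds for P in GL_n(k), which is dense in GL_n(K). *)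
move=> pq P uP; apply/eqP; rewrite -subr_eq0; apply/negPn/negP.
pose X P := eval_tensor p (base_change P (invmx P) G) * q%:F -
            p%:F * eval_tensor q (base_change P (invmx P) G).
rewrite -/(X P) => XP.
(* [x] is the difference [X] at the generic matrix. *)
pose x := generic_eval G p * (q%:F)%:MP%:F +
          (- p%:F)%:MP%:F * generic_eval G q.
have spX Q : Q \in unitmx -> specializes (meval (mx_point Q)) x (X Q).
  move=> uQ; rewrite /X -mulNr.
  apply: specializesD; apply: specializesM.
  - exact: specializes_generic_eval.
  - exact: specializes_mpolyC.
  - exact: specializes_mpolyC.
  - exact: specializes_generic_eval.
have [g ug] := GL_dense c kinf spX uP XP.
(* Base change by [g] is the action of the inverse transpose of [g]. *)
have := pq (invmx g)^T; rewrite unitmx_tr unitmx_inv => /(_ ug).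
move/(congr1 (@FracField.tofrac _)); rewrite !tofracM !tofrac_pullback.
rewrite !trmx_inv !trmxK invmxK map_invmx => e.
by rewrite /X /eval_tensor e subrr eqxx.
Qed.

(* The denominator q of an invariant may vanish on all normal forms: it has to
   be translated by some P in GL_n(k) before being restricted to them. *)
Lemma eval_tensor_nonvanishing (q : PolM k n) : q != 0 ->
  exists2 P : 'M[k]_n, P \in unitmx &
    eval_tensor q (base_change (map_mx c P) (invmx (map_mx c P)) NF) != 0.
Proof.
move=> q0; pose X P := eval_tensor q (base_change P (invmx P) NF).
have uP : invmx (frame G) \in unitmx by rewrite unitmx_inv.
apply: (GL_dense (x := generic_eval NF q) (X := X) c kinf _ uP).
  by move=> Q uQ; apply: specializes_generic_eval.
(* Over K, the inverse of the frame moves the normal form back to the generic tensor, where the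
   value of [q] is [q] itself. *)
rewrite /X (base_change_frame_inv uF).
by rewrite /eval_tensor mmap_generic_tensor tofrac_eq0.
Qed.

(** As [P] and [Q] have entries in k, the coordinates of the translated slice point are polynomials
    over k in the parameters. *)
Lemma eval_slice_point (v : 'I_N -> K) (P Q : 'M[k]_n) (p : PolM k n) :
  exists A : {mpoly k[N]},
    eval_tensor p (base_change (map_mx c P) (map_mx c Q) (slice (extend v))) =
    evalR A v.
Proof.
pose D := base_change (map_mx (@mpolyC N k) P) (map_mx (@mpolyC N k) Q)
  (slice (extend (fun i => 'X_i))).
exists (mmap (@mpolyC N k) (tensor_point D) p).
rewrite /evalR rmorph_mmap; apply: mmap_ext => [a|s] /=; first by rewrite mmapC.
rewrite /tensor_point -coord_map_tensor -map_base_change -!map_mx_comp.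
rewrite map_slice_extend; congr (coord (base_change _ _ _) _).
- by apply: eq_map_mx => a /=; rewrite mmapC.
- by apply: eq_map_mx => a /=; rewrite mmapC.
- apply: eq_slice => t /free_coordP[i ->]; rewrite !extend_enum_val /=.
  by rewrite mmapX mmap1U.
Qed.

(** By invariance, x = p/q can be computed on a k-translate of the generic normal form, where
    numerator and denominator are polynomials over k in the free coordinates. *)
Lemma invariant_generated (x : K) : Defs.invariant x ->
  let f := fun i : 'I_N => coord NF (enum_val i) in
  exists A B : {mpoly k[N]}, evalR B f != 0 /\ x = evalR A f / evalR B f.
Proof.
move=> [p [q [q0 [xE pq]]]] f.
have [P uP] := eval_tensor_nonvanishing q0.
have uPc : map_mx c P \in unitmx by rewrite map_unitmx.
have uPF : map_mx c P *m frame G \in unitmx by rewrite unitmx_mul uPc uF.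
(* The product of [P] with the generic frame takes the generic tensor to the translate by [P] of its
   normal form. Its entries lie in K, hence the need for invariance under GL_n(K). *)
have := invariant_base_change pq uPF.
rewrite -(base_change_normal_form uPc uF).
rewrite -map_invmx normal_form_generic_slice -/f.
have [A ->] := eval_slice_point f P (invmx P) p.
have [B ->] := eval_slice_point f P (invmx P) q.
move=> e B0; exists A, B; split=> //; apply/eqP.
by rewrite xE eqr_div ?tofrac_eq0 // e.
Qed.

End InvariantField.

(** * Dimension zero and conclusion *)

Lemma mpoly_of_no_vars (R : nzRingType) (N : nat) (p : {mpoly R[N]}) :
  N = 0 -> p = (p@_0)%:MP.
Proof.
move=> N0; have eq0 (u : 'X_{1..N}) : u = 0%MM.
  by apply/mnmP=> i; have := ltn_ord i; rewrite {2}N0.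
by apply/mpolyP=> u; rewrite (eq0 u) mcoeffC eqxx mulr1.
Qed.

Lemma invariant_field_rational0 (k : fieldType) :
  invariant_field_rational_of_trdeg k 0 0.
Proof.
have Nc0 : Nc 0 = 0 by rewrite /Nc !card_prod card_ord.
have evalC (a : k) f : evalR a%:MP_[0] f = @constR k 0 a by exact: mmapC.
(* The family is empty, so 0 is a placeholder; every polynomial is constant and the whole function
   field is k. *)
exists (fun=> 0); split; first by case.
split=> [P|x [p [q [q0 [-> _]]]]].
  rewrite (mpoly_of_no_vars P) // evalC mpolyC_eq0.
  by rewrite fmorph_eq0.
exists (p@_0)%:MP, (q@_0)%:MP; rewrite !evalC.
rewrite -/(@constR k 0) /constR -!mpoly_of_no_vars //.
by rewrite tofrac_eq0.
Qed.

Theorem theorem1 (k : closedFieldType) (n : nat) :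
  (2%N \notin [pchar k])%R ->
  invariant_field_rational_of_trdeg k n (n ^ 3 - n ^ 2).
Proof.
move=> _; case: n => [|m]; first exact: invariant_field_rational0.
(* With the degree written as the number of free coordinates, the generators are indexed by their
   enumeration. *)
rewrite -card_free_coord; have kinf := @closed_field_infinite k.
exists (fun i => coord (normal_form (generic_tensor k m.+1)) (enum_val i)).
split; first by move=> i; apply: normal_form_coord_invariant.
split; first exact: normal_form_alg_indep.
by move=> x; apply: invariant_generated.
Qed.
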